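(* Let $k$ be a positive integer and let $G$ be a graph with $m$ edges. If $$\rho(G)>\frac{k-\frac12+\sqrt{4m+(k-\frac12)^2}}{2},$$ then $G$ contains a cycle of length $t$ for every $t$ with $3\leq t\leq 2k+2$.
   Context: $\rho(G)$ denotes the spectral radius of the adjacency matrix of $G$. ''Contains a cycle of length $t$'' means $G$ has a subgraph isomorphic to $C_t$. *)

(* Defs.v *)
From mathcomp Require Import all_boot all_order all_algebra.
From mathcomp Require Import classical_sets reals.
From mathcomp Require Export complex.

Set Implicit Arguments.
Unset Strict Implicit.
Unset Printing Implicit Defensive.

Import Order.TTheory GRing.Theory Num.Theory.

Local Open Scope ring_scope.

(* A finite simple graph is a symmetric irreflexive relation on a finType. *)

Definition edges (T : finType) (e : rel T) : {set {set T}} :=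
  [set [set p.1; p.2]%SET | p : T * T & e p.1 p.2]%SET.

Definition adjmx (K : pzRingType) (T : finType) (e : rel T) : 'M[K]_#|T| :=
  \matrix_(i, j) (e (enum_val i) (enum_val j))%:R.

(* All complex eigenvalues are considered, so that this is the usual notion
   for an arbitrary square matrix; the set is finite, hence the supremum is
   attained, except that it is empty (with supremum 0) when n = 0. *)
Definition spectral_radius (R : realType) (n : nat) (A : 'M[R[i]]_n) : R :=
  sup [set r : R | exists2 z : R[i], eigenvalue A z & r = complex.Re `|z|]%classic.

Definition rho (R : realType) (T : finType) (e : rel T) : R :=
  spectral_radius (adjmx R[i] e).

(* C_t on the vertices 0, ..., t - 1; it is a simple graph for t >= 3. *)
Definition cycle_graph (t : nat) : rel 'I_t :=
  fun i j => (j == ordS i) || (i == ordS j).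

(* e has a (not necessarily induced) subgraph isomorphic to e'. *)
Definition has_subgraph (T' T : finType) (e' : rel T') (e : rel T) : Prop :=
  exists2 f : T' -> T, injective f & forall x y, e' x y -> e (f x) (f y).

Definition contains_cycle (T : finType) (e : rel T) (t : nat) : Prop :=
  has_subgraph (@cycle_graph t) e.

(* Main.v *)
(* Let z be an eigenvalue, r = |z|, and x the vector of moduli of an
   eigenvector, with largest entry x_u; put N = N(u) and c = k - 1/2.  From
   r x_u <= S := sum_(v in N) x_v and r x_v <= sum_(w ~ v) x_w one gets
   r (r - c) x_u <= (r - c) S <= sum_(y) d_N(y) x_y - c S (if r >= c).
   A path on 2k+1 vertices inside N closes up through u into cycles of all
   lengths 3, ..., 2k+2.  Without such a path, the Erdos-Gallai theorem for the
   set L of vertices y of N with d_N(y) >= k gives e(L) <= c |L|, and then the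
   right-hand side is at most m x_u.  Hence r (r - c) <= m, which is the
   negation of the hypothesis; no Perron vector is needed. *)
Require Import Defs.
From mathcomp Require Import all_boot all_order all_algebra.
From mathcomp Require Import boolp classical_sets reals.
From mathcomp Require Import fintype finset zify lra.
Import Order.TTheory GRing.Theory Num.Theory.

Set Implicit Arguments.
Unset Strict Implicit.
Unset Printing Implicit Defensive.

Local Open Scope ring_scope.

Section PathsIn.
Variables (T : finType) (e : rel T).
Hypotheses (e_sym : symmetric e) (e_irr : irreflexive e).
Implicit Types (A B S : {set T}) (s p : seq T).

(** * Paths and adjacency counts inside a vertex set *)

Definition path_in S s := [&& uniq s, sorted e s & all [in S] s].

Definition deg_in S v := (\sum_(w in S) e v w)%N.

(** Ordered adjacent pairs are counted, so an edge with both ends in [A :&: B] counts twice. *)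
Definition links A B := (\sum_(v in A) deg_in B v)%N.

Lemma path_in_take S n s : path_in S s -> path_in S (take n s).
Proof.
case/and3P=> us ps /allP aS; apply/and3P; split.
- exact: take_uniq.
- exact: take_sorted.
- by apply/allP=> x /mem_take; apply: aS.
Qed.

Lemma path_in_sub A B s : A \subset B -> path_in A s -> path_in B s.
Proof.
move=> sAB /and3P[us ps /allP aA]; apply/and3P; split=> //.
by apply/allP=> x /aA /(subsetP sAB).
Qed.

Lemma deg_inE S v : deg_in S v = #|[set w in S | e v w]|.
Proof.
rewrite /deg_in -sum1_card big_mkcond [RHS]big_mkcond; apply: eq_bigr => w _.
by rewrite inE; case: (w \in S); case: (e v w).
Qed.

Lemma deg_in_setID S A v : deg_in S v = (deg_in (S :&: A) v + deg_in (S :\: A) v)%N.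
Proof. exact: big_setID. Qed.

Lemma linksC A B : links A B = links B A.
Proof.
rewrite /links /deg_in exchange_big; apply: eq_bigr => v _.
by apply: eq_bigr => w _; rewrite e_sym.
Qed.

Lemma links_setIDl A B C : links A B = (links (A :&: C) B + links (A :\: C) B)%N.
Proof. exact: big_setID. Qed.

Lemma links_setIDr A B C : links A B = (links A (B :&: C) + links A (B :\: C))%N.
Proof. by rewrite linksC (links_setIDl _ _ C) 2!(linksC _ A). Qed.

Lemma links1l v B : links [set v] B = deg_in B v.
Proof. by rewrite /links big_set1. Qed.

(** * Longest paths and the Erdos-Gallai bound *)

Lemma longest_path_in S : S != set0 ->
  exists x p, path_in S (x :: p) /\
    forall s, path_in S s -> (size s <= size (x :: p))%N.
Proof.
case/set0Pn=> x0 Sx0.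
pose P n := [exists s : n.-tuple T, path_in S s].
have Psize s : path_in S s -> P (size s).
  by move=> ps; apply/existsP; exists (in_tuple s).
have Pmax n : P n -> (n <= #|T|)%N.
  case/existsP=> s /and3P[us _ _].
  by rewrite -{1}(size_tuple s) -(card_uniqP us) max_card.
have P1 : path_in S [:: x0] by rewrite /path_in /= Sx0.
have exP : exists n, P n by exists 1; exact: (Psize [:: x0]).
case: (ex_maxnP exP Pmax) => n /existsP[[[|x p] /= /eqP sn] ps] nmax.
  by have := nmax _ (Psize _ P1); rewrite -sn.
by exists x, p; split=> // s /Psize /nmax; rewrite /= sn.
Qed.

Lemma deg_in_le_count S v s : uniq s ->
  (forall w, w \in S -> e v w -> w \in s) -> (deg_in S v <= count (e v) s)%N.
Proof.
move=> us sub; rewrite deg_inE cardE -size_filter.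
apply: uniq_leq_size; first exact: enum_uniq.
by move=> w; rewrite mem_enum inE mem_filter => /andP[Sw evw]; rewrite evw sub.
Qed.

(** Go from [x] along [p1], jump to the far end of the path, walk back to [z], and return to [x] by
    the edge between [x] and [z]. *)
Lemma rotation_cycle x p1 z p2 :
    path e x (p1 ++ z :: p2) -> e x z -> e (last x p1) (last z p2) ->
  cycle e (x :: p1 ++ rev (z :: p2)).
Proof.
rewrite cat_path /= => /and3P[ep1 _ ep2] exz ey.
rewrite [z :: p2]lastI rev_rcons rcons_cat cat_path ep1 /= ey /= rcons_path.
apply/andP; split.
  by rewrite rev_path; rewrite (eq_path (e' := e)) // => a b; rewrite e_sym.
rewrite e_sym; case: p2 {ep2 ey} => [|a q] //=.
by rewrite rev_cons last_rcons.
Qed.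

(** Pigeonhole on the positions of [p]: [belast x p] lists the predecessors of the entries of [p],
    so some position holds a neighbour of [x] whose predecessor is a neighbour of the last
    vertex. *)
Lemma crossing_index x p :
    (size p < count (e x) p + count (e (last x p)) (belast x p))%N ->
  exists p1 z p2, [/\ p = p1 ++ z :: p2, e x z & e (last x p1) (last z p2)].
Proof.
move=> lt_p.
have [i [ltip exz ey]] : exists i, [/\ (i < size p)%N, e x (nth x p i) &
    e (last x p) (nth x (belast x p) i)].
  case: (boolP [exists i : 'I_(size p), e x (nth x p i) &&
      e (last x p) (nth x (belast x p) i)]) => [/existsP[i /andP[? ?]]|].
    by exists i.
  rewrite negb_exists => /forallP no; exfalso; move: lt_p; apply/negP.
  rewrite -leqNgt -!sum1_count !(big_nth x) size_belast !big_mkord.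
  rewrite big_mkcond [X in (_ + X)%N]big_mkcond -big_split /=.
  rewrite -[X in (_ <= X)%N]card_ord -sum1_card; apply: leq_sum => i _.
  by have := no i; do 2!case: ifP => //.
exists (take i p), (nth x p i), (drop i.+1 p).
have def_p : p = take i p ++ nth x p i :: drop i.+1 p.
  by rewrite -drop_nth // cat_take_drop.
split=> //.
have -> : last (nth x p i) (drop i.+1 p) = last x p by rewrite [in RHS]def_p last_cat.
rewrite e_sym; suff -> : last x (take i p) = nth x (belast x p) i by [].
have -> : nth x (belast x p) i = nth x (x :: p) i.
  by rewrite lastI nth_rcons size_belast ltip.
case: i ltip {exz ey def_p} => [|i] ltip; first by rewrite take0.
by rewrite (take_nth x) ?last_rcons // ltnW.
Qed.

(* The degree conditions force a crossing pair, which turns the path into a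
   cycle on the same vertices; an edge leaving it would give a longer path. *)
Lemma longest_path_closed S k x p :
    path_in S (x :: p) ->
    (forall s, path_in S s -> (size s <= size (x :: p))%N) ->
    (size p < 2 * k)%N -> (k <= deg_in S x)%N -> (k <= deg_in S (last x p))%N ->
  forall v w, v \in x :: p -> w \in S -> e v w -> w \in x :: p.
Proof.
move=> Pxp maxp ltp degx degy.
have /and3P[uxp pxp /allP aS] := Pxp.
(* By maximality, no path through exactly the vertices of [x :: p] extends at its front by a new
   vertex of [S]. *)
have ext a s : perm_eq s (x :: p) -> sorted e (a :: s) -> a \in S -> a \in x :: p.
  move=> pm es Sa; apply/negP => /negP na.
  have /maxp : path_in S (a :: s).
    rewrite /path_in cons_uniq (perm_uniq pm) (perm_mem pm) na uxp es /= Sa.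
    by apply/allP=> b; rewrite (perm_mem pm); apply: aS.
  by rewrite /= (perm_size pm) ltnn.
have nbx w : w \in S -> e x w -> w \in p.
  move=> Sw exw; have /= := ext w (x :: p) (perm_refl _).
  rewrite e_sym exw => /(_ pxp Sw); rewrite inE => /predU1P[wx|//].
  by rewrite wx e_irr in exw.
have nby w : w \in S -> e (last x p) w -> w \in belast x p.
  move=> Sw eyw; have /= := ext w (rev (x :: p)).
  rewrite perm_rev perm_refl => /(_ isT).
  rewrite lastI rev_rcons /= e_sym eyw rev_path.
  rewrite (eq_path (e' := e)) => [|a b]; last by rewrite e_sym.
  move=> /(_ pxp Sw); rewrite mem_rcons inE => /predU1P[wx|//].
  by rewrite wx e_irr in eyw.
have ubel : uniq (belast x p) by move: uxp; rewrite lastI rcons_uniq => /andP[].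
have up : uniq p by case/andP: uxp.
have cx := leq_trans degx (deg_in_le_count up nbx).
have cy := leq_trans degy (deg_in_le_count ubel nby).
have [|p1 [z [p2 [def_p exz ey]]]] := @crossing_index x p; first by lia.
have cyc : cycle e (x :: p1 ++ rev (z :: p2)).
  by apply: rotation_cycle => //; rewrite -def_p.
have pm : perm_eq (x :: p1 ++ rev (z :: p2)) (x :: p).
  by rewrite def_p perm_cons perm_cat2l perm_rev.
(* Cut open just before [v], the cycle becomes a path starting at [v], to which [w] can be
   prepended. *)
move=> v w; rewrite -(perm_mem pm) => /rot_to[i c rot_c] Sw evw.
apply: (ext w (v :: c)) => //.
  by rewrite -rot_c perm_rot.
rewrite /= e_sym evw /=; move: cyc; rewrite -(rot_cycle i) rot_c /=.
by rewrite rcons_path => /andP[].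
Qed.

(* The Erdos-Gallai theorem; [links S S] is twice the number of edges in S. *)
Lemma links_path_free S k :
    (forall s, path_in S s -> size s <> (2 * k).+1) ->
  (links S S <= (2 * k).-1 * #|S|)%N.
Proof.
have [n] := ubnP #|S|; elim: n S => // n IHn S ltSn noP.
have [->|S_n0] := eqVneq S set0; first by rewrite /links big_set0.
have [x [p [Pxp maxp]]] := longest_path_in S_n0.
have /and3P[uxp pxp /allP aS] := Pxp.
(* A longer path could be truncated to exactly [2 * k + 1] vertices. *)
have ltp : (size p < 2 * k)%N.
  rewrite ltnNge; apply/negP => le_p.
  apply: (noP _ (path_in_take (2 * k).+1 Pxp)).
  by rewrite size_takel.
(* Deleting a vertex of degree at most [k - 1] loses at most [2 * k - 2] ordered pairs, so induction
   applies. *)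
have low v : v \in S -> (deg_in S v < k)%N -> (links S S <= (2 * k).-1 * #|S|)%N.
  move=> Sv degv.
  have sub : S :\ v \subset S by exact: subsetDl.
  have cS := cardsD1 v S; rewrite Sv in cS.
  have IH : (links (S :\ v) (S :\ v) <= (2 * k).-1 * #|S :\ v|)%N.
    apply: IHn; first by lia.
    by move=> s /(path_in_sub sub); apply: noP.
  have SIv : S :&: [set v] = [set v].
    by apply/setIidPr; rewrite sub1set.
  rewrite (links_setIDl _ _ [set v]) SIv links1l.
  rewrite (links_setIDr _ _ [set v]) SIv (linksC _ [set v]) links1l.
  have := deg_in_setID S [set v] v; rewrite SIv => degE.
  rewrite cS mulnDr muln1 addnA; apply: leq_add => //; lia.
have [/(low x)->//|degx] := ltnP (deg_in S x) k; first by apply: aS; rewrite mem_head.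
have [/(low (last x p))->//|degy] := ltnP (deg_in S (last x p)) k.
  by apply: aS; rewrite mem_last.
have closed := longest_path_closed Pxp maxp ltp degx degy.
pose A := [set v in x :: p].
have SIA : S :&: A = A.
  by apply/setIidPr/subsetP => v; rewrite inE; apply: aS.
have cA : #|A| = (size p).+1 by rewrite cardsE (card_uniqP uxp).
have cS : #|S| = (#|A| + #|S :\: A|)%N by rewrite -(cardsID A S) SIA.
(* Both ends of the path now have degree at least [k], so its vertex set [A] has no edge to the rest
   of [S]: the bound splits over [A] and [S :\: A]. *)
have AD0 : links A (S :\: A) = 0%N.
  apply: big1 => v Av; apply: big1 => w; rewrite !inE => /andP[nAw Sw].
  case evw: (e v w) => //; case/negP: nAw.
  by rewrite -in_cons (closed v w) //; move: Av; rewrite inE.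
have IH : (links (S :\: A) (S :\: A) <= (2 * k).-1 * #|S :\: A|)%N.
  apply: IHn; first by lia.
  by move=> s /(path_in_sub (subsetDl S A)); apply: noP.
(* [A] has at most [2 * k] vertices, hence degrees at most [2 * k - 1] inside it. *)
have AA : (links A A <= (2 * k).-1 * #|A|)%N.
  rewrite mulnC -sum_nat_const; apply: leq_sum => v Av.
  apply: (@leq_trans #|A :\ v|); last by have := cardsD1 v A; rewrite Av; lia.
  rewrite deg_inE; apply: subset_leq_card; apply/subsetP => w.
  rewrite !inE => /andP[-> evw]; rewrite andbT.
  by apply: contraTneq evw => ->; rewrite e_irr.
rewrite (links_setIDl _ _ A) SIA (links_setIDr A S A) (links_setIDr (S :\: A) S A).
rewrite SIA AD0.
by rewrite (linksC _ A) AD0 addn0 add0n cS mulnDr leq_add.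
Qed.

(** * From edge counts and paths to the graph *)

(** An edge [[set a; b]] arises only from the ordered pairs [(a, b)] and [(b, a)]. *)
Lemma links_setT_le : (links setT setT <= 2 * #|edges e|)%N.
Proof.
have -> : links setT setT = #|[set p : T * T | e p.1 p.2]|.
  rewrite /links /deg_in pair_big /= -sum1_card [RHS]big_mkcond /=.
  by apply: eq_big => [[a b]|[a b] _]; rewrite !inE //=; case: (e a b).
have edgesE : edges e =
    [set [set p.1; p.2] | p in [set p : T * T | e p.1 p.2]].
  by apply/setP=> s; apply/imsetP/imsetP => -[p Ep ->]; exists p => //;
    move: Ep; rewrite inE.
rewrite -sum1_card (partition_big_imset (fun p : T * T => [set p.1; p.2])) /=.
rewrite -edgesE.
rewrite mulnC -sum_nat_const; apply: leq_sum => s /imsetP[[a b] _ ->] /=.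
rewrite sum1dep_card.
apply: (@leq_trans #|[set (a, b); (b, a)]|); last by rewrite cards2; case: eqP.
apply: subset_leq_card; apply/subsetP => -[c d].
rewrite !inE /= => /andP[_ /eqP/setP eq_s].
have := eq_s a; have := eq_s b; have := eq_s c; have := eq_s d.
rewrite !inE !eqxx !orbT /= !xpair_eqE.
rewrite ![a == _]eq_sym ![b == _]eq_sym.
case: (c == a); case: (d == b); case: (c == b); case: (d == a) => //.
Qed.

(** The first [t - 1] vertices of the path, preceded by [u], form the cycle, since [u] is adjacent
    to both ends. *)
Lemma contains_cycle_of_path_in u s t : (3 <= t)%N ->
    path_in [set v | e u v] s -> (t.-1 <= size s)%N ->
  contains_cycle e t.
Proof.
move=> t3 /(path_in_take t.-1); set q := take _ s => Pq le_s.
have szq : size (u :: q) = t by rewrite /= size_takel //; lia.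
have /and3P[uq pq /allP aN] := Pq.
have nuq : u \notin q by apply/negP => /aN; rewrite inE e_irr.
have pathq : path e u q.
  by case: (q) pq aN => //= a q' -> /(_ a); rewrite mem_head inE => ->.
exists (fun i : 'I_t => nth u (u :: q) i).
  move=> i j /eqP; rewrite nth_uniq ?szq // ?cons_uniq ?nuq //.
  by move/eqP/val_inj.
suff step (i j : 'I_t) : j == ordS i -> e (nth u (u :: q) i) (nth u (u :: q) j).
  by move=> i j /orP[|] /step //; rewrite e_sym.
move=> /eqP->; have lt_it := ltn_ord i.
rewrite [nat_of_ord (ordS i)]/=.
have [lt_i|ge_i] := ltnP i.+1 t.
  rewrite modn_small //; apply: (pathP u pathq).
  by rewrite -ltnS -[(size q).+1]/(size (u :: q)) szq.
(* The last index wraps around to [0], that is, to [u]. *)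
have -> : i.+1 = t by lia.
rewrite modnn e_sym.
have : nth u (u :: q) i \in q.
  case: (nat_of_ord i) lt_it ge_i => [|n] //=; first by lia.
  by move=> ? ?; apply: mem_nth; move: szq => /=; lia.
by move/aN; rewrite inE.
Qed.


(** * Weighted inequalities and the spectral bound *)

Lemma nbhd_weight_le (R : realFieldType) (x : T -> R) (M : R) (u : T) (k : nat) :
    (0 < k)%N -> (forall v, 0 <= x v <= M) ->
    (forall s, path_in [set v | e u v] s -> size s <> (2 * k).+1) ->
  \sum_(w in [set v | e u v]) \sum_y (e w y)%:R * x y
    - (k%:R - 1 / 2) * \sum_(w in [set v | e u v]) x w <= #|edges e|%:R * M.
Proof.
set N := [set v | e u v] => k_gt0 xM noP.
set c : R := k%:R - 1 / 2.
pose L := [set y in N | (k <= deg_in N y)%N].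
have sLN : L \subset N by apply/subsetP => y; rewrite inE => /andP[].
have NIL : N :&: L = L by apply/setIidPr.
have M_ge0 : 0 <= M by have /andP[] := xM u; apply: le_trans.
have LL_le : (links L L <= (2 * k).-1 * #|L|)%N.
  by apply: links_path_free => s /(path_in_sub sLN); apply: noP.
have LL_leR : (links L L)%:R <= 2 * c * #|L|%:R.
  have -> : 2 * c = (2 * k).-1%:R.
    rewrite -subn1 natrB ?natrM /c; last by lia.
    by rewrite mulrBr mul1r divff // pnatr_eq0.
  by rewrite -natrM ler_nat.
(* [links L N] counts the edges inside [L] twice; this excess is half of [links L L], which
   [c * #|L|] absorbs. *)
have links_le : (2 * links (~: N) N + 2 * links L N <= 2 * #|edges e| + links L L)%N.
  have := links_setT_le.
  rewrite (links_setIDl _ _ N) (links_setIDr (setT :&: N) _ N).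
  rewrite (links_setIDr (setT :\: N) _ N) setTI setTD (linksC N (~: N)).
  rewrite (links_setIDl N N L) (links_setIDr (N :\: L) N L) NIL.
  rewrite (linksC (N :\: L) L) (links_setIDr L N L) NIL; lia.
have links_leR : 2 * (links (~: N) N)%:R + 2 * (links L N)%:R
    <= 2 * #|edges e|%:R + (links L L)%:R :> R.
  by rewrite -!natrM -!natrD ler_nat.
have -> : \sum_(w in N) \sum_y (e w y)%:R * x y = \sum_y (deg_in N y)%:R * x y.
  rewrite exchange_big; apply: eq_bigr => y _.
  by rewrite natr_sum mulr_suml; apply: eq_bigr => w _; rewrite e_sym.
rewrite (bigID [in N]) /= addrAC mulr_sumr -sumrB.
(* Degrees are integers and [c] is [k - 1/2], so the coefficient of [x y] is positive on [L], where
   [x y] is replaced by [M], and negative on the rest of [N], which is dropped. *)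
have in_le : \sum_(y in N) ((deg_in N y)%:R * x y - c * x y)
    <= ((links L N)%:R - c * #|L|%:R) * M.
  rewrite [leLHS](big_setID L) /= NIL -[leRHS]addr0; apply: lerD.
    rewrite /links natr_sum mulrBl -mulrA mulr_natl -sumr_const mulr_suml mulr_sumr.
    rewrite -sumrB; apply: ler_sum => y; rewrite inE => /andP[_ degy].
    rewrite -!mulrBl; apply: ler_wpM2l; last by have /andP[] := xM y.
    by rewrite /c; move: degy; rewrite -(ler_nat R); lra.
  apply: sumr_le0 => y; rewrite !inE => /andP[+ Ny]; rewrite Ny /= -ltnNge => degy.
  rewrite -mulrBl; apply: mulr_le0_ge0; last by have /andP[] := xM y.
  by rewrite /c; move: degy; rewrite -(ler_nat R) -natr1; lra.
have out_le : \sum_(y | y \notin N) (deg_in N y)%:R * x y <= (links (~: N) N)%:R * M.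
  rewrite /links natr_sum mulr_suml (eq_bigl [in ~: N]) => [|y]; last by rewrite !inE.
  apply: ler_sum => y _; apply: ler_wpM2l => //.
  by have /andP[] := xM y.
apply: le_trans (lerD in_le out_le) _.
rewrite -mulrDl; apply: ler_wpM2r => //.
lra.
Qed.

Lemma weight_ratio_le (R : realFieldType) (x : T -> R) (r : R) (u : T) (k : nat) :
    (0 < k)%N -> (forall v, 0 <= x v <= x u) -> 0 < x u -> 0 <= r ->
    (forall v, r * x v <= \sum_w (e v w)%:R * x w) ->
    (forall s, path_in [set v | e u v] s -> size s <> (2 * k).+1) ->
  r * (r - (k%:R - 1 / 2)) <= #|edges e|%:R.
Proof.
move=> k_gt0 xM xu_gt0 r_ge0 le_x noP.
have := nbhd_weight_le k_gt0 xM noP.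
set c := _ - _ / _; set S := \sum_(w in _) x w; set D := \sum_(w in _) _.
(* If [r < c], the left-hand side is at most [0]. *)
have [lt_rc _|le_cr] := ltrP r c.
  apply: (@le_trans _ _ 0) => //; apply: mulr_ge0_le0 => //.
  by rewrite subr_le0 ltW.
have le_S : r * x u <= S.
  apply: le_trans (le_x u) _; rewrite /S [leRHS]big_mkcond.
  apply: ler_sum => w _; rewrite inE.
  by case: (e u w); rewrite ?mul1r ?mul0r.
have le_D : r * S <= D by rewrite mulr_sumr; apply: ler_sum => w _; apply: le_x.
move=> le_m; rewrite -(ler_pM2r xu_gt0).
have := ler_wpM2l (_ : 0 <= r - c) le_S; rewrite subr_ge0 => /(_ le_cr).
nra.
Qed.

Lemma eigenvalue_bound (R : rcfType) (z : R[i]) (k : nat) :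
    (0 < k)%N -> eigenvalue (adjmx R[i] e) z ->
    (forall u s, path_in [set v | e u v] s -> size s <> (2 * k).+1) ->
  complex.Re `|z| * (complex.Re `|z| - (k%:R - 1 / 2)) <= #|edges e|%:R.
Proof.
move=> k_gt0 /eigenvalueP[a eig a_n0] noP.
have ReE (y : R[i]) : complex.Re `|y| = Normc.normc y by case: y.
pose x v := Normc.normc (a 0 (enum_rank v)).
have x_ge0 v : 0 <= x v by rewrite /x; case: (a _ _) => b d /=; apply: sqrtr_ge0.
have [i ai] : exists i, a 0 i != 0 by apply/rV0Pn.
have xi_gt0 : 0 < x (enum_val i).
  rewrite lt_def x_ge0 andbT /x enum_valK.
  by apply: contra ai => /eqP/Normc.eq0_normc->.
case: (@Order.TotalTheory.arg_maxP _ _ _ (enum_val i) xpredT x isT) => u _ maxu.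
rewrite ReE; apply: (@weight_ratio_le _ x _ u) => //; last exact: noP.
- by move=> v; rewrite x_ge0; apply: maxu.
- exact: lt_le_trans xi_gt0 (maxu _ isT).
- by case: (z) => b d; apply: sqrtr_ge0.
(* The triangle inequality in the eigenvector equation; symmetry of [e] lets the row eigenvector
   serve. *)
move=> v; rewrite /x -Normc.normcM.
have -> : z * a 0 (enum_rank v) = \sum_w (e v w)%:R * a 0 (enum_rank w).
  have := congr1 (fun b : 'rV_#|T| => b 0 (enum_rank v)) eig; rewrite !mxE => <-.
  rewrite (reindex (@enum_rank T)) /=; last exact/onW_bij/enum_rank_bij.
  by apply: eq_bigr => w _; rewrite mxE !enum_rankK e_sym mulrC.
apply: (big_ind2 (fun y b => Normc.normc y <= b)).
- by rewrite Normc.normc0.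
- move=> y1 b1 y2 b2 le1 le2; apply: le_trans (le_normcD _ _) _.
  exact: lerD.
- move=> w _; rewrite Normc.normcM; case: (e v w).
    by rewrite Normc.normc1.
  by rewrite Normc.normc0.
Qed.

Lemma rho_bound (R : realType) (k : nat) : (0 < k)%N ->
    (forall u s, path_in [set v | e u v] s -> size s <> (2 * k).+1) ->
  rho R e <= (k%:R - 1 / 2
    + Num.sqrt (4 * #|edges e|%:R + (k%:R - 1 / 2) ^+ 2)) / 2.
Proof.
move=> k_gt0 noP; set c := k%:R - 1 / 2; set m : R := #|edges e|%:R.
have c_ge0 : 0 <= c by rewrite /c; move: k_gt0; rewrite -(ler_nat R); lra.
have sqrt_ge0 := sqrtr_ge0 (4 * m + c ^+ 2).
rewrite /rho /spectral_radius; set E := (X in sup X).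
(* With no eigenvalue the supremum is [0], below the bound since [c >= 0]. *)
have [->|/set0P E_n0] := eqVneq E classical_sets.set0.
  by rewrite sup0; lra.
apply: ge_sup => // r [z eig_z ->].
have := eigenvalue_bound k_gt0 eig_z noP; rewrite -/c -/m.
set y := complex.Re _ => le_m.
(* Completing the square: [y * (y - c) <= m] means [(2 * y - c) ^+ 2 <= 4 * m + c ^+ 2]. *)
have : 2 * y - c <= Num.sqrt (4 * m + c ^+ 2).
  apply: le_trans (ler_norm _) _; rewrite -sqrtr_sqr; apply: ler_wsqrtr.
  rewrite !expr2; nra.
lra.
Qed.

End PathsIn.

Theorem theorem1p5 (R : realType) (T : finType) (e : rel T)
    (e_sym : symmetric e) (e_irr : irreflexive e)
    (k m : nat) (k_gt0 : (0 < k)%N) (card_edges : #|edges e| = m)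
    (rho_gt : rho R e >
      (k%:R - 1 / 2 + Num.sqrt (4 * m%:R + (k%:R - 1 / 2) ^+ 2)) / 2)
    (t : nat) (t_range : (3 <= t <= 2 * k + 2)%N) :
  contains_cycle e t.
Proof.
case/andP: t_range => t_ge3 t_le.
apply: contrapT => no_cycle; move: rho_gt; rewrite -card_edges ltNge.
(* A path on [2 * k + 1] vertices in a neighbourhood is long enough because [t - 1 <= 2 * k + 1]. *)
rewrite rho_bound // => u s Ps sz; apply: no_cycle.
by apply: (contains_cycle_of_path_in e_sym e_irr t_ge3 Ps); lia.
Qed.
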